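(* (1) Let $p=x^2+y^2$ and $q=x^3-3xy^2$. Then $\mathbb{R}[x,y]^{D_3}\cap\mathbb{Z}[x,y]=\mathbb{Z}[p,q]$. (2) For every $d\in\mathbb{N}$ the morphism $g_d$ on $\mathbb{C}^2/D_3\simeq\mathbb{C}^2$ is defined over $\mathbb{Z}$, i.e. $g_d(p,q)=(P_d(p,q),Q_d(p,q))$ with $P_d,Q_d\in\mathbb{Z}[p,q]$.
   Context: $\mathbb{N}=\{1,2,\dots\}$. $D_3\subset GL(2,\mathbb{R})$ is the dihedral group of order 6 generated by the rotation of the $(x,y)$-plane by $2\pi/3$ and the reflection $(x,y)\mapsto(x,-y)$; $\mathbb{R}[x,y]^{D_3}$ is its ring of invariant polynomials. One has $\mathbb{C}[x,y]^{D_3}=\mathbb{C}[p,q]$ with $p,q$ algebraically independent, and $\tilde F:\mathbb{C}^2\to\mathbb{C}^2$, $\tilde F(x,y)=(x^2+y^2,\,x^3-3xy^2)$, is surjective and identifies $\mathbb{C}^2/D_3$ with $\mathbb{C}^2$ (coordinates $(p,q)$). The Chebyshev endomorphism $P_{A_2}^d:\mathbb{C}^2\to\mathbb{C}^2$ is defined by $P_{A_2}^d(e_1(t),e_2(t))=(e_1(t^d),e_2(t^d))$ for $t=(t_1,t_2,t_3)\in(\mathbb{C}^* )^3$ with $t_1t_2t_3=1$, where $t^d=(t_1^d,t_2^d,t_3^d)$ and $e_j$ is the $j$-th elementary symmetric polynomial. With the linear isomorphism $M_2(x,y)=(x+iy,\,x-iy)$ put $f_d=M_2^{-1}\circ P_{A_2}^d\circ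 M_2:\mathbb{C}^2\to\mathbb{C}^2$. Then $g_d:\mathbb{C}^2\to\mathbb{C}^2$ is the unique polynomial map with $g_d\circ\tilde F=\tilde F\circ f_d$. *)

(* Defs.v *)
From HB Require Import structures.
From mathcomp Require Import all_boot all_order all_algebra.
From mathcomp Require Import reals complex.
From mathcomp Require Import mpoly ring.
(* Not imported: the notations of MathComp-Analysis clash with those of mpoly. *)
From mathcomp Require trigo.

Set Implicit Arguments.
Unset Strict Implicit.
Unset Printing Implicit Defensive.

Import Order.TTheory GRing.Theory Num.Theory.
Local Open Scope ring_scope.
Local Open Scope complex_scope.

Section Dihedral.
Variable R : realType.

Definition rotation (a : R) : 'M[R]_2 :=
  \matrix_(i, j)
    if i == j then trigo.cos a
    else if i == 0 then - trigo.sin a else trigo.sin a.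

Definition reflection : 'M[R]_2 :=
  \matrix_(i, j) if i == j then (-1) ^+ (i : nat) else 0.

Inductive D3 : 'M[R]_2 -> Prop :=
| D3_rotation : D3 (rotation (2 * trigo.pi / 3))
| D3_reflection : D3 reflection
| D3_one : D3 1%:M
| D3_mul g h : D3 g -> D3 h -> D3 (g *m h)
| D3_inv g : D3 g -> D3 (invmx g).

(* The polynomial v |-> P (g v), v a column vector. *)
Definition linear_subst (g : 'M[R]_2) (P : {mpoly R[2]}) : {mpoly R[2]} :=
  P \mPo [tuple \sum_(j < 2) g i j *: 'X_j | i < 2].

Definition D3_invariant (P : {mpoly R[2]}) : Prop :=
  forall g, D3 g -> linear_subst g P = P.

Definition inv_p : {mpoly R[2]} := 'X_0 ^+ 2 + 'X_1 ^+ 2.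
Definition inv_q : {mpoly R[2]} := 'X_0 ^+ 3 - 3 *: ('X_0 * 'X_1 ^+ 2).

Definition in_Zpq (P : {mpoly R[2]}) : Prop :=
  exists S : {mpoly int[2]}, P = map_mpoly intr S \mPo [tuple inv_p; inv_q].

End Dihedral.

Section Chebyshev.
Variable R : realType.
Local Notation C := (R[i]).

Definition elem_sym (j : nat) (t : 3.-tuple C) : C := (mesym 3 C j).@[tnth t].

Definition tpow (d : nat) (t : 3.-tuple C) : 3.-tuple C :=
  [tuple tnth t i ^+ d | i < 3].

(* t lies in the torus t_1 t_2 t_3 = 1 (which forces t_i <> 0) and lies over z. *)
Definition torus_over (z : C * C) (t : 3.-tuple C) : bool :=
  (\prod_(i < 3) tnth t i == 1) && ((elem_sym 1 t, elem_sym 2 t) == z).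

Lemma elem_sym3 (t : 3.-tuple C) : elem_sym 3 t = \prod_(i < 3) tnth t i.
Proof.
by rewrite /elem_sym mesymnnE rmorph_prod; apply: eq_bigr => i _;
  exact: mevalXU.
Qed.

Lemma coef_prod_elem_sym (t : 3.-tuple C) (j : nat) : (j <= 3)%N ->
  (\prod_(c <- t) ('X - c%:P))`_(3 - j) = (-1) ^+ j * elem_sym j t.
Proof. by move=> j3; exact: (mroots_coeff t (Ordinal (j3 : (j < 4)%N))). Qed.

Lemma elem_sym_perm (j : nat) (s t : 3.-tuple C) : (j <= 3)%N ->
  perm_eq s t -> elem_sym j s = elem_sym j t.
Proof.
move=> j3 st; have nz : (-1) ^+ j != 0 :> C by rewrite signr_eq0.
by apply: (mulfI nz); rewrite -!coef_prod_elem_sym // (perm_big _ st).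
Qed.

Lemma elem_sym_inj_perm (s t : 3.-tuple C) :
  elem_sym 1 s = elem_sym 1 t -> elem_sym 2 s = elem_sym 2 t ->
  elem_sym 3 s = elem_sym 3 t ->
  perm_eq s t.
Proof.
move=> e1 e2 e3; apply: prod_XsubC_eq; apply/polyP => k.
have [k3|k3] := leqP k 3; last first.
  by rewrite !nth_default // size_prod_XsubC size_tuple.
have kk : (3 - k <= 3)%N by rewrite leq_subr.
rewrite -(subKn k3) !coef_prod_elem_sym //; congr (_ * _).
case: k {k3 kk} => [|[|[|k]]] //.
by rewrite !subSS sub0n /elem_sym !mesym0E !rmorph1.
Qed.

Lemma torus_overP (z : C * C) : exists t, torus_over z t.
Proof.
pose p : {poly C} := 'X^3 + (- z.1 *: 'X^2 + (z.2 *: 'X - 1)).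
have sp : size p = 4.
  rewrite size_polyDl ?size_polyXn //.
  apply: leq_ltn_trans (size_polyD _ _) _; rewrite gtn_max.
  rewrite (leq_ltn_trans (size_scale_leq _ _)) ?size_polyXn //=.
  apply: leq_ltn_trans (size_polyD _ _) _; rewrite gtn_max.
  rewrite (leq_ltn_trans (size_scale_leq _ _)) ?size_polyX //=.
  by rewrite size_polyN size_poly1.
have lp : lead_coef p = 1.
  by rewrite lead_coefE sp /p !coefE /= !mulr0 !(addr0, subr0).
have [r Dp] := closed_field_poly_normal p; rewrite lp scale1r in Dp.
have sr : size r == 3 by move: sp; rewrite Dp size_prod_XsubC => -[->].
have cp k : p`_k = (k == 3)%:R + (- z.1 * (k == 2)%:R
    + (z.2 * (k == 1)%:R - (k == 0)%:R)).
  by rewrite /p !coefD coefN !coefZ !coefXn coefX coef1.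
have c0 : p`_0 = - 1 by rewrite cp !mulr0 !add0r.
have c1 : p`_1 = z.2 by rewrite cp mulr0 mulr1 subr0 !add0r.
have c2 : p`_2 = - z.1 by rewrite cp mulr0 mulr1 subr0 addr0 add0r.
pose t := Tuple sr; exists t; rewrite /torus_over -elem_sym3.
have := @coef_prod_elem_sym t 1 isT; have := @coef_prod_elem_sym t 2 isT.
have := @coef_prod_elem_sym t 3 isT; rewrite /= -Dp c0 c1 c2 sqrrN !expr1.
rewrite exprS sqrrN expr1n mulr1 mul1r !mulN1r.
move=> /oppr_inj <- <- /oppr_inj <-.
by rewrite eqxx -surjective_pairing /=.
Qed.

(* Independent of the choice of t: see chebyshevE. *)
Definition chebyshev (d : nat) (z : C * C) : C * C :=
  let t := xchoose (torus_overP z) in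
  (elem_sym 1 (tpow d t), elem_sym 2 (tpow d t)).

Lemma chebyshevE (d : nat) (t : 3.-tuple C) :
  \prod_(i < 3) tnth t i = 1 ->
  chebyshev d (elem_sym 1 t, elem_sym 2 t) =
  (elem_sym 1 (tpow d t), elem_sym 2 (tpow d t)).
Proof.
move=> t1; rewrite /chebyshev; set z := (elem_sym 1 t, elem_sym 2 t).
have := xchooseP (torus_overP z); set s := xchoose _.
case/andP => /eqP s1 /eqP[e1 e2].
have st : perm_eq s t by apply: elem_sym_inj_perm; rewrite // !elem_sym3 s1.
have std : perm_eq (tpow d s) (tpow d t).
  have E (u : 3.-tuple C) : tpow d u = map (fun x => x ^+ d) u :> seq C.
    by rewrite /= -[in RHS](map_tnth_enum u) -map_comp.
  by rewrite !E perm_map.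
by rewrite !(elem_sym_perm _ std).
Qed.

(* Named because 'i in ring_scope is an unspecified square root of -1. *)
Definition ii : C := 0 +i* 1.

Definition M2 (z : C * C) : C * C := (z.1 + ii * z.2, z.1 - ii * z.2).
Definition M2_inv (w : C * C) : C * C :=
  ((w.1 + w.2) / 2, (w.1 - w.2) / (2 * ii)).

Lemma ii_neq0 : ii != 0.
Proof. by rewrite eq_complex /= oner_eq0 andbF. Qed.

Lemma M2K : cancel M2 M2_inv.
Proof.
move=> [x y]; rewrite /M2 /M2_inv /=; have := ii_neq0.
by move: ii => i i0; congr (_, _); field; rewrite ?i0 ?pnatr_eq0.
Qed.

Lemma M2_invK : cancel M2_inv M2.
Proof.
move=> [x y]; rewrite /M2 /M2_inv /=; have := ii_neq0.
by move: ii => i i0; congr (_, _); field; rewrite ?i0 ?pnatr_eq0.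
Qed.

Definition f_map (d : nat) (z : C * C) : C * C := M2_inv (chebyshev d (M2 z)).

Definition F_map (z : C * C) : C * C :=
  (z.1 ^+ 2 + z.2 ^+ 2, z.1 ^+ 3 - 3 * z.1 * z.2 ^+ 2).

Definition eval2 (P : {mpoly C[2]}) (z : C * C) : C :=
  P.@[tnth [tuple z.1; z.2]].

Definition polynomial_map (g : C * C -> C * C) : Prop :=
  exists P Q : {mpoly C[2]}, forall z, g z = (eval2 P z, eval2 Q z).

Definition is_g (d : nat) (g : C * C -> C * C) : Prop :=
  polynomial_map g /\ forall z, g (F_map z) = F_map (f_map d z).

Definition defined_over_Z (g : C * C -> C * C) : Prop :=
  exists P Q : {mpoly int[2]}, forall z,
    g z = (eval2 (map_mpoly intr P) z, eval2 (map_mpoly intr Q) z).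

End Chebyshev.

(* Main.v *)
(* Let W in Z[x,y] be D3-invariant. By the reflection W(0,y) is even, W(0,y) = e(y^2),
   so W - e(p) is invariant and vanishes on x = 0, hence on the three lines whose
   union is q = 0. As q is monic in x, W - e(p) = A q with A in Z[x,y], again
   invariant and of smaller degree in y; by induction W is in Z[p,q].

   Newton's identities for t_1^d, t_2^d, t_3^d show that in the real coordinates
   x + i y, x - i y the map f_d is a pair (a, b) in Z[x,y]^2. Then a^2 + b^2 and
   a^3 - 3 a b^2 are D3-invariant, because a + i b picks up the factor w^d when
   x + i y is multiplied by a cube root of unity w and is conjugated when x + i y
   is; so they lie in Z[p,q], and the corresponding map is g_d. Uniqueness is the
   surjectivity of F. *)
Require Import Defs.
From HB Require Import structures.
From mathcomp Require Import all_boot all_order all_algebra.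
From mathcomp Require Import reals complex.
From mathcomp Require Import mpoly ring lra polyXY.
From mathcomp Require trigo boolp.
Import Order.TTheory GRing.Theory Num.Theory.
Local Open Scope ring_scope.
Set Implicit Arguments.
Unset Strict Implicit.
Unset Printing Implicit Defensive.

(* Convention: the outer variable goes to x, the inner one to y. *)
Definition ev2 (A : comNzRingType) (x y : A) : {poly {poly int}} -> A :=
  horner_eval x \o map_poly (horner_eval y \o map_poly intr).

HB.instance Definition _ (A : comNzRingType) (x y : A) :=
  GRing.RMorphism.on (ev2 x y).

(** * Evaluation of integer polynomials in two variables *)

Section EvalTheory.
Implicit Types (A B : comNzRingType) (W : {poly {poly int}}).

Lemma ev2_coef_wide A (x y : A) n W : (size W <= n)%N ->
  ev2 x y W = \sum_(i < n) (map_poly intr W`_i).[y] * x ^+ i.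
Proof.
move=> leWn; rewrite /ev2 /= /horner_eval.
rewrite (horner_coef_wide _ (leq_trans (size_poly _ _) leWn)).
by apply: eq_bigr => i _; rewrite coef_map_id0 //= rmorph0 /horner_eval horner0.
Qed.

Lemma ev2_0l A (y : A) W : ev2 0 y W = (map_poly intr W`_0).[y].
Proof.
rewrite (ev2_coef_wide _ _ (leqnSn _)) big_ord_recl expr0 mulr1 big1 ?addr0 // => i _.
by rewrite exprS mul0r mulr0.
Qed.

Lemma ev2C A (x y : A) (c : {poly int}) :
  ev2 x y c%:P = (map_poly intr c).[y].
Proof. by rewrite /ev2 /= map_polyC /= /horner_eval hornerC. Qed.

Lemma ev2X A (x y : A) : ev2 x y 'X = x.
Proof. by rewrite /ev2 /= map_polyX /horner_eval hornerX. Qed.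

Lemma ev2Y A (x y : A) : ev2 x y 'X%:P = y.
Proof. by rewrite ev2C map_polyX hornerX. Qed.

(** Integer coefficients are fixed by every ring morphism. This carries identities from Z[x,y] to
    values, to substitutions and to [{mpoly R[2]}]. *)
Lemma rmorph_ev2 A B (f : {rmorphism A -> B}) (x y : A) W :
  f (ev2 x y W) = ev2 (f x) (f y) W.
Proof.
rewrite !(ev2_coef_wide _ _ (leqnn _)) rmorph_sum; apply: eq_bigr => i _ /=.
rewrite rmorphM rmorphXn -horner_map -map_poly_comp /=; congr (_.[_] * _).
by apply: eq_map_poly => k; rewrite /= rmorph_int.
Qed.

Lemma ev2_ev2 A (x y : A) (U V W : {poly {poly int}}) :
  ev2 x y (ev2 U V W) = ev2 (ev2 x y U) (ev2 x y V) W.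
Proof. exact: rmorph_ev2. Qed.

End EvalTheory.

Lemma ev2_mpoly (R : comNzRingType) (S : {mpoly int[2]}) :
  exists W, map_mpoly intr S = ev2 'X_0 'X_1 W :> {mpoly R[2]}.
Proof.
rewrite (mpolyE S) rmorph_sum /=.
apply: (big_ind (fun P : {mpoly R[2]} => exists W, P = ev2 'X_0 'X_1 W)).
- by exists 0; rewrite rmorph0.
- by move=> _ _ [U ->] [V ->]; exists (U + V); rewrite rmorphD.
move=> m _; exists ((S@_m)%:~R * ('X ^+ m 0 * 'X%:P ^+ m 1)).
rewrite map_mpolyZ map_mpolyX rmorphM rmorph_int rmorphM !rmorphXn /=.
rewrite ev2X ev2Y mpolyXE_id !big_ord_recl big_ord0 mulr1.
by rewrite -mul_mpolyC rmorph_int; congr (_ * (_ * 'X_ _ ^+ m _)); apply: val_inj.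
Qed.

(** * Linear substitutions as a right action on polynomials *)

Section LinearSubst.
Variable R : realType.
Implicit Types (P Q : {mpoly R[2]}) (g h : 'M[R]_2).

HB.instance Definition _ g := GRing.RMorphism.copy (linear_subst g)
  (comp_mpoly [tuple \sum_(j < 2) g i j *: 'X_j | i < 2]).
HB.instance Definition _ g := GRing.Linear.copy (linear_subst g)
  (comp_mpoly [tuple \sum_(j < 2) g i j *: 'X_j | i < 2]).

Lemma linear_substX g i : linear_subst g 'X_i = \sum_j g i j *: 'X_j.
Proof. by rewrite /linear_subst comp_mpolyXU -tnth_nth tnth_mktuple. Qed.

Lemma linear_subst_mul g h P :
  linear_subst h (linear_subst g P) = linear_subst (g *m h) P.
Proof.
rewrite (mpolyE P) [linear_subst g _]rmorph_sum [LHS]rmorph_sum [RHS]rmorph_sum.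
apply: eq_bigr => m _ /=.
rewrite !linearZ /= mpolyXE_id !rmorph_prod; congr (_ *: _).
apply: eq_bigr => i _; rewrite /= !rmorphXn /= !linear_substX rmorph_sum /=.
congr (_ ^+ _); under eq_bigr do rewrite linearZ /= linear_substX scaler_sumr.
rewrite exchange_big; apply: eq_bigr => j _; rewrite mxE scaler_suml.
by apply: eq_bigr => k _; rewrite scalerA.
Qed.

Lemma linear_subst1 P : linear_subst 1%:M P = P.
Proof.
rewrite -[RHS]comp_mpoly_id; congr (_ \mPo _); apply: eq_from_tnth => i.
rewrite !tnth_mktuple (bigD1 i) //= big1 ?addr0 ?mxE ?eqxx ?scale1r // => j ji.
by rewrite mxE eq_sym (negPf ji) scale0r.
Qed.

Lemma D3_invariantP P :
  linear_subst (rotation (2 * trigo.pi / 3)) P = P ->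
  linear_subst (reflection R) P = P -> D3_invariant P.
Proof.
move=> rotP refP g; elim=> // [|{}g h _ gP _ hP|{}g _ gP].
- exact: linear_subst1.
- by rewrite -linear_subst_mul gP hP.
(* By default [invmx] returns a singular matrix unchanged, so that case is the induction
   hypothesis. *)
have [gu|gu] := boolP (g \in unitmx); last by rewrite invmx_out.
by rewrite -[in LHS]gP linear_subst_mul mulmxV // linear_subst1.
Qed.

Lemma meval_linear_subst g P v :
  (linear_subst g P).@[v] = P.@[fun i => \sum_j g i j * v j].
Proof.
rewrite comp_mpoly_meval; apply: meval_eq => i.
rewrite tnth_mktuple rmorph_sum; apply: eq_bigr => j _.
by rewrite /= mevalZ mevalXU.
Qed.

End LinearSubst.

(** * The rotation by a third of a turn *)

Section Rotation.
Variable R : realType.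
Local Notation theta := (2 * trigo.pi / 3 : R).

(** The triple angle formulas at 2 pi give s (3 - 4 s^2) = 0 and c^3 - 3 c s^2 = 1; as s > 0, the
    first yields s^2 = 3/4 and the second becomes linear in c. *)
Lemma cos_2pi3 : trigo.cos theta = - 2^-1.
Proof.
have pi0 := trigo.pi_gt0 R.
have s0 : 0 < trigo.sin theta by apply: trigo.sin_gt0_pi; lra.
have a3 : theta + (theta + theta) = trigo.pi *+ 2 by rewrite -mulr_natl; field.
have := trigo.sin2pi R; have := trigo.cos2pi R; rewrite -a3 !(trigo.sinD, trigo.cosD).
have := trigo.cos2Dsin2 theta; move: s0.
move: (trigo.cos _) (trigo.sin _) => c s s0 cs1 cos3 sin3.
have s2 : s ^+ 2 = 3 / 4.
  by apply: (mulfI (lt0r_neq0 s0)); nra.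
have c2 : c ^+ 2 = 1 / 4 by lra.
have : c * c ^+ 2 - 3 * c * s ^+ 2 = 1 by lra.
by rewrite s2 c2; lra.
Qed.

Lemma sin_2pi3 : trigo.sin theta ^+ 2 = 3 / 4.
Proof.
by rewrite trigo.sin2cos2 cos_2pi3; field.
Qed.

Lemma linear_subst_rotation0 : linear_subst (rotation theta) 'X_0 =
  (trigo.cos theta)%:MP * 'X_0 - (trigo.sin theta)%:MP * 'X_1.
Proof.
by rewrite linear_substX !big_ord_recl big_ord0 !mxE /= addr0 !mul_mpolyC scaleNr.
Qed.

Lemma linear_subst_rotation1 : linear_subst (rotation theta) 'X_1 =
  (trigo.sin theta)%:MP * 'X_0 + (trigo.cos theta)%:MP * 'X_1.
Proof.
by rewrite linear_substX !big_ord_recl big_ord0 !mxE /= addr0 !mul_mpolyC.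
Qed.

Lemma linear_subst_reflection0 : linear_subst (reflection R) 'X_0 = 'X_0.
Proof.
by rewrite linear_substX !big_ord_recl big_ord0 !mxE /= addr0 scale0r addr0 scale1r.
Qed.

Lemma linear_subst_reflection1 : linear_subst (reflection R) 'X_1 = - 'X_1.
Proof.
by rewrite linear_substX !big_ord_recl big_ord0 !mxE /= scale0r addr0 add0r scaleN1r.
Qed.
End Rotation.

(** * The generators p and q over the integers, and degrees in y *)

Definition pW : {poly {poly int}} := 'X ^+ 2 + ('X ^+ 2)%:P.
Definition qW : {poly {poly int}} := 'X ^+ 3 - (3 * 'X ^+ 2)%:P * 'X.

Lemma ev2_pW (A : comNzRingType) (x y : A) : ev2 x y pW = x ^+ 2 + y ^+ 2.
Proof. by rewrite /pW rmorphD /= ev2C [ev2 _ _ _]rmorphXn /= map_polyXn hornerXn /= ev2X. Qed.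

Lemma ev2_qW (A : comNzRingType) (x y : A) :
  ev2 x y qW = x ^+ 3 - 3 * x * y ^+ 2.
Proof.
rewrite /qW rmorphB /= [ev2 _ _ (_ ^+ 3)]rmorphXn rmorphM /= ev2C ev2X.
rewrite rmorphM rmorph_nat rmorphXn /= map_polyX -polyC_natr hornerCM hornerXn.
by ring.
Qed.

Lemma horner_map_intr (c q : {poly int}) : (map_poly intr c).[q] = c \Po q.
Proof.
congr (_.[_]); apply: eq_map_poly => k.
by rewrite -[in RHS](intz k) !rmorph_int.
Qed.

Lemma map_poly_intr_eq0 (R : numDomainType) (c : {poly int}) :
  (forall y : R, (map_poly intr c).[y] = 0) -> c = 0.
Proof.
move=> c0; apply: (map_inj_poly (f := intr : int -> R) intr_inj) => //.
rewrite map_poly0; set p := map_poly _ _ in c0 *.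
(* The naturals below [size p] are more distinct roots than the degree allows. *)
apply: (@roots_geq_poly_eq0 _ _ [seq k%:R | k <- iota 0 (size p)]).
- by apply/allP => _ /mapP[k _ ->]; apply/rootP/c0.
- by rewrite map_inj_uniq ?iota_uniq // => i j /eqP; rewrite eqr_nat => /eqP.
by rewrite size_map size_iota.
Qed.

(** The power of y is cancelled in the domain Z[y], so the point y = 0 causes no trouble. *)
Lemma map_polyX_intr_eq0 (R : numDomainType) n (c : {poly int}) :
  (forall y : R, y ^+ n * (map_poly intr c).[y] = 0) -> c = 0.
Proof.
move=> c0; have : 'X^n * c = 0.
  apply: (@map_poly_intr_eq0 R) => y.
  by rewrite rmorphM /= map_polyXn hornerM hornerXn.
by move/eqP; rewrite mulf_eq0 expf_eq0 polyX_eq0 andbF => /eqP.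
Qed.

(** In c = e(y^2) + o(y^2) y, comparing the values at y and -y leaves 2 y o(y^2) = 0. *)
Lemma poly_evenP (R : realFieldType) (c : {poly int}) :
  (forall y : R, (map_poly intr c).[- y] = (map_poly intr c).[y]) ->
  even_poly c \Po 'X^2 = c.
Proof.
move=> c_even; rewrite -[RHS]poly_even_odd; set e := _ \Po _; set o := _ \Po _.
suff -> : o = 0 by rewrite mul0r addr0.
apply: (@map_polyX_intr_eq0 R 1) => y.
have := c_even y; rewrite -(poly_even_odd c) -/e -/o rmorphD rmorphM /=.
rewrite map_polyX !hornerE /e /o !map_comp_poly /= !map_polyXn !horner_comp.
by rewrite !hornerXn sqrrN; move: _.[_] _.[_] => u v; lra.
Qed.

Lemma qW_monic : qW \is monic.
Proof.
rewrite monicE /qW lead_coefDl ?lead_coefXn // size_polyN size_polyXn.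
by rewrite mul_polyC (leq_ltn_trans (size_scale_leq _ _)) // size_polyX.
Qed.

Lemma size_qW : size qW = 4%N.
Proof.
rewrite /qW size_polyDl ?size_polyXn // size_polyN.
by rewrite mul_polyC (leq_ltn_trans (size_scale_leq _ _)) // size_polyX.
Qed.

(** As a polynomial in y, q has degree 2 and leading coefficient -3x, and degrees add over a domain.
    This makes the induction on the degree in y terminate. *)
Lemma sizeY_mulqW W : W != 0 -> sizeY (W * qW) = (sizeY W).+2.
Proof.
move=> W0; rewrite !sizeYE rmorphM size_mul ?swapXY_eq0 ?(monic_neq0 qW_monic) //.
suff -> : size (swapXY qW) = 3%N by rewrite addn3.
rewrite /qW rmorphB /= [swapXY (_ ^+ 3)]rmorphXn rmorphM /= !swapXY_polyC swapXY_X.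
rewrite rmorphM rmorph_nat /= map_polyXn.
rewrite -polyC_exp -polyC_natr mulrAC -polyCM addrC -mulNr -polyCN.
have c0 : - (3 * 'X : {poly int}) != 0.
  by rewrite oppr_eq0 mulf_eq0 polyX_eq0 orbF -polyC_natr polyC_eq0.
rewrite size_polyDl size_Cmul ?size_polyXn //.
by rewrite (leq_ltn_trans (size_polyC_leq1 _)).
Qed.

(** The left side is e(p), and p has the same degree in y as y^2. Hence subtracting e(p) from W,
    where e(y^2) = W(0,y), does not raise the degree in y. *)
Lemma sizeY_horner_pW e : (sizeY (ev2 qW pW e%:P) <= size (e \Po 'X^2))%N.
Proof.
have [->|e0] := eqVneq e 0; first by rewrite rmorph0 sizeYE rmorph0 size_poly0.
rewrite sizeYE [swapXY _](_ : _ = e^:P \Po ('X ^+ 2 + ('X ^+ 2)%:P)); last first.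
  rewrite ev2C -horner_map -map_poly_comp /comp_poly -map_poly_comp /=.
  rewrite rmorphD rmorphXn /= swapXY_X swapXY_polyC map_polyXn -polyC_exp addrC.
  congr (_.[_]); apply: eq_map_poly => k.
  by rewrite /= -[in RHS](intz k) !rmorph_int.
apply: leq_trans (size_comp_poly_leq _ _) _.
have ex0 : e \Po 'X^2 != 0 by rewrite comp_poly_eq0 ?size_polyXn.
rewrite -[X in (_ <= X)%N]prednK ?size_poly_gt0 // ltnS size_comp_poly size_polyXn.
rewrite size_map_inj_poly //; last exact: polyC_inj.
by rewrite size_polyDl ?size_polyXn // (leq_ltn_trans (size_polyC_leq1 _)).
Qed.

(** * Invariant integer polynomials are polynomials in p and q *)

Section Core.
Variable R : realType.
Local Notation theta := (2 * trigo.pi / 3 : R).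
Local Notation toM := (ev2 'X_0 'X_1 : _ -> {mpoly R[2]}).

Local Notation c := (mpolyC 2 (trigo.cos theta)).
Local Notation s := (mpolyC 2 (trigo.sin theta)).

Lemma ev2_D3 W g : D3_invariant (toM W) -> D3 g -> forall x y : R,
  ev2 (g 0 0 * x + g 0 1 * y) (g 1 0 * x + g 1 1 * y) W = ev2 x y W.
Proof.
move=> Winv Dg x y; pose v (i : 'I_2) := if i == 0 then x else y.
have E u : (toM W).@[u] = ev2 (u 0) (u 1) W by rewrite rmorph_ev2 /= !mevalXU.
have := congr1 (meval v) (Winv g Dg); rewrite meval_linear_subst !E => <-.
have l1 : lift ord0 ord0 = 1 :> 'I_2 by apply: val_inj.
by rewrite !big_ord_recl !big_ord0 !addr0 /= !l1.
Qed.

Lemma inv_pE : inv_p R = toM pW. Proof. by rewrite ev2_pW; congr (_ + _). Qed.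

Lemma inv_qE : inv_q R = toM qW.
Proof. by rewrite ev2_qW /inv_q scaler_nat; congr (_ - _); ring. Qed.

Lemma D3_invariant_ev2P W :
  ev2 (c * 'X_0 - s * 'X_1) (s * 'X_0 + c * 'X_1) W = toM W ->
  ev2 'X_0 (- 'X_1) W = toM W -> D3_invariant (toM W).
Proof.
move=> rotW refW; apply: D3_invariantP; rewrite rmorph_ev2 /=.
  by rewrite -[RHS]rotW linear_subst_rotation0 linear_subst_rotation1.
by rewrite -[RHS]refW linear_subst_reflection0 linear_subst_reflection1.
Qed.

(** Norm 1 together with the real and imaginary parts of (c + i s)^3 = 1, in the form in which
    [ring] uses them to show p and q invariant. *)
Lemma rotation_cube :
  [/\ s ^+ 2 = 1 - c ^+ 2, c ^+ 3 = 1 + 3 * c * s ^+ 2 & s ^+ 3 = 3 * c ^+ 2 * s].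
Proof.
have <- : 3%:MP = 3 :> {mpoly R[2]} by exact: mpolyC_nat.
rewrite -mpolyC1 -!rmorphXn -!rmorphM -rmorphB -rmorphD /=.
have s2 := sin_2pi3 R; rewrite cos_2pi3.
split; congr (_%:MP); first by rewrite s2; field.
  by rewrite s2; field.
by rewrite exprS s2; field.
Qed.

Lemma D3_invariant_inv_p : D3_invariant (inv_p R).
Proof.
rewrite inv_pE; apply: D3_invariant_ev2P; rewrite !ev2_pW ?sqrrN //.
by have [cs _ _] := rotation_cube; ring: cs.
Qed.

Lemma D3_invariant_inv_q : D3_invariant (inv_q R).
Proof.
rewrite inv_qE; apply: D3_invariant_ev2P; rewrite !ev2_qW ?sqrrN //.
by have [_ c3 s3] := rotation_cube; ring: c3 s3.
Qed.

Lemma D3_invariant_mulIq W :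
  D3_invariant (toM (W * qW)) -> D3_invariant (toM W).
Proof.
have q0 : toM qW != 0.
  (* At the point (1, 0) the value of q is 1. *)
  apply/eqP => /(congr1 (meval (fun i => (i == 0)%:R))).
  rewrite rmorph_ev2 /= !mevalXU ev2_qW expr1n expr0n mulr0 subr0.
  by move/eqP; rewrite meval0 oner_eq0.
move=> WqI g Dg; apply: (mulIf q0); rewrite -[RHS]rmorphM -[RHS](WqI g Dg).
by rewrite [toM (W * _)]rmorphM [RHS]rmorphM /= -inv_qE D3_invariant_inv_q.
Qed.

(* D3 permutes the three lines x = 0, x = sqrt 3 y, x = - sqrt 3 y on which q
   vanishes. *)
Lemma ev2_on_lines W : D3_invariant (toM W) ->
  (forall y : R, ev2 0 y W = 0) -> forall y : R,
  let r := 2 * trigo.sin theta * y in ev2 r y W = 0 /\ ev2 (- r) y W = 0.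
Proof.
move=> Winv W0 y r; have := ev2_D3 Winv (D3_rotation R).
rewrite !mxE /= cos_2pi3 => rotW; split.
  (* The rotation carries (0, -2y) to (r, y). *)
  rewrite -[RHS](W0 (- (2 * y))) -[RHS]rotW.
  by congr (ev2 _ _ W); rewrite /r; lra.
(* The reflection takes (-r, y) to (-r, -y), which is the rotated image of (0, 2y). *)
have := ev2_D3 Winv (D3_reflection R) (- r) y; rewrite !mxE /= expr0 expr1 => <-.
rewrite -[RHS](W0 (2 * y)) -[RHS]rotW.
by congr (ev2 _ _ W); rewrite /r; lra.
Qed.

(** The remainder of W modulo q, monic of degree 3 in x, is b0 + b1 x + b2 x^2. It agrees with W,
    hence vanishes, on the lines x = 0, r, -r: this kills b0, and then the odd and even parts in r
    kill b1 and b2. *)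
Lemma dvd_qW W : D3_invariant (toM W) -> W`_0 = 0 -> exists A, W = A * qW.
Proof.
move=> Winv W0; have W0y y : ev2 (0 : R) y W = 0.
  by rewrite ev2_0l W0 rmorph0 horner0.
have Wl := ev2_on_lines Winv W0y.
have [A [B [WE sB]]] : exists A B, W = A * qW + B /\ (size B <= 3)%N.
  exists (Pdiv.Ring.rdivp W qW), (Pdiv.Ring.rmodp W qW); split.
    exact: Pdiv.RingMonic.rdivp_eq qW_monic W.
  by rewrite -ltnS -size_qW Pdiv.Ring.ltn_rmodpN0 // monic_neq0 // qW_monic.
have WB x y : x ^+ 3 - 3 * x * y ^+ 2 = 0 -> ev2 x y W = ev2 x y B :> R.
  by move=> q0; rewrite WE rmorphD rmorphM /= ev2_qW q0 mulr0 add0r.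
pose b i (y : R) := (map_poly intr B`_i).[y].
have BE x y : ev2 x y B = b 0 y + b 1 y * x + b 2 y * x ^+ 2.
  rewrite (ev2_coef_wide _ _ sB) !big_ord_recl big_ord0 /=.
  by rewrite /b expr0 mulr1 expr1 addr0 addrA.
have b0 y : b 0 y = 0 by rewrite /b -ev2_0l -WB ?W0y //; ring.
set s' := trigo.sin theta in Wl.
have s2 : s' ^+ 2 = 3 / 4 := sin_2pi3 R.
have s0 : s' != 0.
  by apply: contra_eq_neq s2 => ->; rewrite expr0n /= lt_eqF //; lra.
have b12 y : b 1 y * y = 0 /\ b 2 y * y ^+ 2 = 0.
  have [] := Wl y; set r := 2 * s' * y => P1 P2.
  have r2 : r ^+ 2 = 3 * y ^+ 2 by rewrite /r !exprMn s2; field.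
  rewrite WB in P1; last by rewrite exprS r2; ring.
  rewrite WB in P2; last by rewrite exprS sqrrN r2; ring.
  rewrite !BE b0 !add0r ?sqrrN r2 in P1 P2; split.
    by apply: (mulfI s0); rewrite /r in P1 P2; lra.
  by lra.
have B1 : B`_1 = 0.
  by apply: (@map_polyX_intr_eq0 R 1) => y; rewrite expr1 mulrC; case: (b12 y).
have B2 : B`_2 = 0.
  by apply: (@map_polyX_intr_eq0 R 2) => y; rewrite mulrC; case: (b12 y).
have B0 : B`_0 = 0 by apply: (@map_poly_intr_eq0 R).
exists A; rewrite WE [B](_ : _ = 0) ?addr0 //; apply/polyP => -[|[|[|i]]].
1-3: by rewrite coef0.
by rewrite coef0 nth_default // (leq_trans sB).
Qed.

(* Induction on the degree in y: e is the polynomial with e(y^2) = W(0, y), and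
   W - e(p) is divisible by q. *)
Theorem invariant_int_poly W : D3_invariant (toM W) ->
  exists S, W = ev2 qW pW S.
Proof.
have [n] := ubnP (sizeY W); elim: n W => // n IHn W leWn Winv.
pose e := even_poly W`_0; pose W1 := W - ev2 qW pW e%:P.
have eE : e \Po 'X^2 = W`_0.
  apply: (@poly_evenP R) => y.
  have Hb z : (map_poly intr W`_0).[z] = ev2 0 z W :> R.
    by rewrite ev2_0l.
  have := ev2_D3 Winv (D3_reflection R) 0 y; rewrite !mxE /= expr0 expr1 !Hb => <-.
  by congr (ev2 _ _ W); ring.
have W1_inv : D3_invariant (toM W1).
  move=> g Dg; rewrite /W1 [toM _]rmorphB [LHS]rmorphB /= (Winv g Dg).
  rewrite ev2_ev2 -inv_pE -inv_qE [linear_subst g (ev2 _ _ _)]rmorph_ev2 /=.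
  by rewrite D3_invariant_inv_p // D3_invariant_inv_q.
have [||A W1E] := @dvd_qW W1 => //.
  (* The coefficient of x^0 is the value at (0, y), where p becomes y^2. *)
  rewrite coefB -eE; apply/eqP; rewrite subr_eq0; apply/eqP.
  rewrite -[RHS]comp_polyXr -!horner_map_intr -ev2_0l ev2_ev2 ev2C ev2_pW.
  by rewrite expr0n add0r.
have sW1 : (sizeY W1 <= sizeY W)%N.
  rewrite sizeYE rmorphB (leq_trans (size_polyD _ _)) // size_polyN geq_max.
  rewrite -!sizeYE leqnn (leq_trans (sizeY_horner_pW e)) // eE.
  exact: max_size_coefXY.
(* The degree drop under division by q requires a nonzero quotient; for [A] = 0 already W = e(p). *)
have [A0|A0] := eqVneq A 0.
  exists e%:P; apply/eqP; rewrite -subr_eq0.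
  by apply/eqP; rewrite -/W1 W1E A0 mul0r.
have [||S AE] := IHn A.
- rewrite W1E sizeY_mulqW // in sW1.
  by rewrite -ltnS (leq_trans _ leWn) // ltnS (leq_trans _ sW1).
- by apply: D3_invariant_mulIq; rewrite -W1E.
(* The outer variable stands for q and the inner one for p: W = e(p) + S(q,p) q. *)
exists (e%:P + S * 'X); rewrite rmorphD rmorphM /= ev2X -AE -W1E.
by rewrite /W1 addrC subrK.
Qed.
End Core.

(** * The Chebyshev recursion in real coordinates and its symmetries *)

Section PairArithmetic.
Variable A : comNzRingType.
Implicit Types z w e : A * A.

(* The pair (a, b) stands for a + i b. *)
Definition cmul z w : A * A :=
  (z.1 * w.1 - z.2 * w.2, z.1 * w.2 + z.2 * w.1).
Definition cconj z : A * A := (z.1, - z.2).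
Definition cnorm z : A := z.1 ^+ 2 + z.2 ^+ 2.
(** The real part of (a + i b)^3; with [cnorm] it forms the map F. *)
Definition ccube z : A := z.1 ^+ 3 - 3 * z.1 * z.2 ^+ 2.

(* The power sums of t_1, t_2, t_3 with elementary symmetric functions z, conj z
   and 1, by Newton's identities. *)
Fixpoint cheb z d : A * A :=
  match d with
  | 0 => (3, 0)
  | 1 => z
  | 2 => cmul z z - cconj z *+ 2
  | (((k.+1) as k1).+1 as k2).+1 =>
      cmul z (cheb z k2) - cmul (cconj z) (cheb z k1) + cheb z k
  end.

Lemma chebS z d : cheb z d.+3 =
  cmul z (cheb z d.+2) - cmul (cconj z) (cheb z d.+1) + cheb z d.
Proof. by []. Qed.

Lemma nat_ind3 (P : nat -> Prop) : P 0 -> P 1 -> P 2 ->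
  (forall n, P n -> P n.+1 -> P n.+2 -> P n.+3) -> forall n, P n.
Proof.
move=> P0 P1 P2 PS n; suff [] : [/\ P n, P n.+1 & P n.+2] by [].
by elim: n => // n [Pn Pn1 Pn2]; split=> //; apply: PS.
Qed.

Lemma cheb_cconj z d : cheb (cconj z) d = cconj (cheb z d).
Proof.
elim/nat_ind3: d => [||| n /= -> -> ->] //=.
- by congr (_, _); rewrite oppr0.
- by congr (_, _) => /=; ring.
by congr (_, _) => /=; ring.
Qed.

Lemma cmul1z z : cmul (1, 0) z = z.
Proof. by case: z => a b; congr (_, _) => /=; ring. Qed.

(** The hypotheses say that w is a cube root of unity of norm 1; both properties pass to the power e
    = w^d. *)
Lemma cmul_pow (w : A * A) d :
  cmul w w = cconj w -> cmul w (cconj w) = (1, 0) ->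
  let e := iter d (cmul w) (1, 0) in
  cnorm e = 1 /\ cmul e (cmul e e) = (1, 0).
Proof.
move=> w2 w3; have w1 : cnorm w = 1.
  by have := congr1 fst w3; rewrite /= mulrN opprK -!expr2.
elim: d => [|d [IH1 IH3]] /=; first by split; rewrite /cnorm /cmul /=; [|congr (_, _)]; ring.
set e := iter d _ _ in IH1 IH3 *; split.
  have -> : cnorm (cmul w e) = cnorm w * cnorm e by rewrite /cnorm /=; ring.
  by rewrite w1 IH1 mulr1.
have -> : cmul (cmul w e) (cmul (cmul w e) (cmul w e)) =
          cmul (cmul w (cmul w w)) (cmul e (cmul e e)).
  by congr (_, _) => /=; ring.
by rewrite IH3 w2 w3 /cmul /=; congr (_, _); ring.
Qed.

(** Scaling every t_i by w turns e_1, e_2, e_3 into w e_1, w^2 e_2, e_3 and the d-th power sum into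
    w^d times itself. The proof follows this through the recursion. *)
Lemma cheb_cmul w z d : cmul w w = cconj w -> cmul w (cconj w) = (1, 0) ->
  cheb (cmul w z) d = cmul (iter d (cmul w) (1, 0)) (cheb z d).
Proof.
move=> w2 w3; elim/nat_ind3: d => [||| n] /=.
- by congr (_, _) => /=; ring.
- by congr (_, _) => /=; ring.
- have -> : cmul w (cmul w (1, 0)) = cconj w.
    by rewrite -w2; congr (_, _) => /=; ring.
  have -> : cmul (cmul w z) (cmul w z) = cmul (cconj w) (cmul z z).
    by rewrite -w2; congr (_, _) => /=; ring.
  by congr (_, _) => /=; ring.
set e := iter n _ _ => /= -> -> ->.
have w3e : cmul w (cmul w (cmul w e)) = e.
  transitivity (cmul (cmul w (cmul w w)) e); first by congr (_, _) => /=; ring.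
  by rewrite w2 w3 cmul1z.
(* The factors w and conj w from the coefficients complete the powers of w, by w^3 = 1 and w conj w
   = 1, so that each term keeps the factor e = w^n. *)
have uT T : cmul (cmul w z) (cmul (cmul w (cmul w e)) T) = cmul e (cmul z T).
  by rewrite -[e in RHS]w3e; congr (_, _) => /=; ring.
have vT T : cmul (cconj (cmul w z)) (cmul (cmul w e) T)
    = cmul e (cmul (cconj z) T).
  by rewrite -[RHS]cmul1z -w3; congr (_, _) => /=; ring.
by rewrite w3e uT vT; congr (_, _) => /=; ring.
Qed.

Lemma cnorm_cheb_cmul w z d : cmul w w = cconj w -> cmul w (cconj w) = (1, 0) ->
  cnorm (cheb (cmul w z) d) = cnorm (cheb z d).
Proof.
move=> w2 w3; rewrite cheb_cmul //; have [] := cmul_pow d w2 w3.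
move: (iter _ _ _) (cheb z d) => e T e1 _.
by rewrite -[RHS]mul1r -e1 /cnorm /=; ring.
Qed.

Lemma ccube_cheb_cmul w z d : cmul w w = cconj w -> cmul w (cconj w) = (1, 0) ->
  ccube (cheb (cmul w z) d) = ccube (cheb z d).
Proof.
move=> w2 w3; rewrite cheb_cmul //; have [] := cmul_pow d w2 w3.
move: (iter _ _ _) (cheb z d) => e T _ e3.
have ccubeE u : ccube u = (cmul u (cmul u u)).1 by rewrite /ccube /=; ring.
rewrite !ccubeE; have -> : cmul (cmul e T) (cmul (cmul e T) (cmul e T)) =
    cmul (cmul e (cmul e e)) (cmul T (cmul T T)) by congr (_, _) => /=; ring.
by rewrite e3 /=; ring.
Qed.

Lemma cnorm_cheb_cconj z d : cnorm (cheb (cconj z) d) = cnorm (cheb z d).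
Proof. by rewrite cheb_cconj /cnorm /= sqrrN. Qed.

Lemma ccube_cheb_cconj z d : ccube (cheb (cconj z) d) = ccube (cheb z d).
Proof. by rewrite cheb_cconj /ccube /= sqrrN. Qed.

End PairArithmetic.

Lemma rmorph_cheb (A B : comNzRingType) (f : {rmorphism A -> B}) z d :
  cheb (f z.1, f z.2) d = (f (cheb z d).1, f (cheb z d).2).
Proof.
elim/nat_ind3: d => [||| n /= -> -> ->] /=.
- by rewrite rmorph_nat rmorph0.
- by [].
- by congr (_, _) => /=; rewrite !(rmorphD, rmorphB, rmorphM, rmorphN, rmorphMn).
by congr (_, _) => /=; rewrite !(rmorphD, rmorphB, rmorphM, rmorphN).
Qed.

Definition cnorm_chebW d : {poly {poly int}} := cnorm (cheb ('X, 'X%:P) d).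
Definition ccube_chebW d : {poly {poly int}} := ccube (cheb ('X, 'X%:P) d).

Lemma ev2_cheb (A : comNzRingType) (x y : A) d :
  (ev2 x y (cheb ('X, 'X%:P) d).1, ev2 x y (cheb ('X, 'X%:P) d).2)
  = cheb (x, y) d.
Proof. by rewrite -rmorph_cheb /= ev2X ev2Y. Qed.

Lemma ev2_cnorm_chebW (A : comNzRingType) (x y : A) d :
  ev2 x y (cnorm_chebW d) = cnorm (cheb (x, y) d).
Proof. by rewrite -ev2_cheb /cnorm_chebW /cnorm rmorphD !rmorphXn. Qed.

Lemma ev2_ccube_chebW (A : comNzRingType) (x y : A) d :
  ev2 x y (ccube_chebW d) = ccube (cheb (x, y) d).
Proof.
rewrite -ev2_cheb /ccube_chebW /ccube rmorphB /= [ev2 _ _ (_ ^+ 3)]rmorphXn.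
by rewrite !rmorphM rmorph_nat.
Qed.

(** * Invariance of the two components of F composed with f_d *)

Section D3Cheb.
Variable R : realType.
Local Notation theta := (2 * trigo.pi / 3 : R).
Local Notation toM := (ev2 'X_0 'X_1 : _ -> {mpoly R[2]}).
Local Notation w := (mpolyC 2 (trigo.cos theta), mpolyC 2 (trigo.sin theta)).

Lemma rotation_cmul : cmul w w = cconj w /\ cmul w (cconj w) = (1, 0).
Proof.
have s2 := sin_2pi3 R; have c := cos_2pi3 R.
rewrite /cmul /cconj /= -!mpolyCN -!mpolyCM -!mpolyCB -!mpolyCD -mpolyC1 -mpolyC0.
by split; congr (_%:MP, _%:MP); rewrite c; lra.
Qed.

(** On pairs the rotation is multiplication by [w] and the reflection is conjugation. *)
Lemma D3_invariant_cnorm d : D3_invariant (toM (cnorm_chebW d)).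
Proof.
apply: D3_invariant_ev2P; rewrite !ev2_cnorm_chebW.
  have [w2 w3] := rotation_cmul; rewrite -[RHS](cnorm_cheb_cmul _ d w2 w3).
  by congr (cnorm (cheb (_, _) d)); rewrite addrC.
exact: (cnorm_cheb_cconj ('X_0, 'X_1)).
Qed.

Lemma D3_invariant_ccube d : D3_invariant (toM (ccube_chebW d)).
Proof.
apply: D3_invariant_ev2P; rewrite !ev2_ccube_chebW.
  have [w2 w3] := rotation_cmul; rewrite -[RHS](ccube_cheb_cmul _ d w2 w3).
  by congr (ccube (cheb (_, _) d)); rewrite addrC.
exact: (ccube_cheb_cconj ('X_0, 'X_1)).
Qed.

End D3Cheb.

(** * The complex maps f_d and F *)

Section Complex.
Variable R : realType.
Local Notation C := R[i].
Implicit Types (z : C * C) (a b c : C).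

Lemma sqr_ii : ii R ^+ 2 = -1.
Proof. by apply/eqP; rewrite eq_complex /= !mul0r !mulr0 !mulr1 !add0r oppr0 !eqxx. Qed.

Lemma elem_sym12 a b c :
  (elem_sym 1 [tuple a; b; c], elem_sym 2 [tuple a; b; c])
  = (a + b + c, a * b + a * c + b * c).
Proof.
have prodE : \prod_(x <- [:: a; b; c]) ('X - x%:P) = 'X^3 - (a + b + c) *: 'X^2
    + (a * b + a * c + b * c) *: 'X - (a * b * c)%:P.
  by rewrite !big_cons big_nil -!mul_polyC !rmorphD !rmorphM /=; ring.
have := @coef_prod_elem_sym _ [tuple a; b; c] 1 isT.
have := @coef_prod_elem_sym _ [tuple a; b; c] 2 isT.
rewrite /= prodE !(coefD, coefN, coefZ, coefXn, coefX, coefC) /= => e2 e1.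
congr (_, _).
  by apply: oppr_inj; rewrite -mulN1r -[X in X * _]expr1 -e1; ring.
by rewrite -[LHS]mul1r -[X in X * _](expr1n _ 2) -sqrrN -e2; ring.
Qed.

(** As t_1 t_2 t_3 = 1, e_2(t^d) is the power sum of the inverses of the t_i, so it obeys the
    recursion of e_1(t^d) with e_1 and e_2 exchanged. In the coordinates of [M2] this exchange is
    the formal sign change of [ii]. *)
Lemma chebyshev_M2 d z : chebyshev d (M2 z) = M2 (cheb z d).
Proof.
have [t /andP[/eqP t1 /eqP tz]] := torus_overP (M2 z).
rewrite -[in LHS]tz chebyshevE //.
have [a [b [c tE]]] : exists a b c, t = [tuple a; b; c].
  case: t t1 tz => [[|a [|b [|c []]]] //= st] _ _.
  by exists a, b, c; apply: val_inj.
have tpowE : tpow d t = [tuple a ^+ d; b ^+ d; c ^+ d].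
  apply: val_inj; transitivity (map (fun x => x ^+ d) t); last by rewrite tE.
  by rewrite /= -[in RHS](map_tnth_enum t) -map_comp.
rewrite tpowE; move: t1 tz; rewrite tE !elem_sym12 !big_ord_recl big_ord0 mulr1 /=.
rewrite !(tnth_nth 0) /= mulrA => abc; rewrite [M2 z]/M2 => -[e1 e2].
have i2 := sqr_ii.
suff [-> ->] : a ^+ d + b ^+ d + c ^+ d = (cheb z d).1 + ii R * (cheb z d).2 /\
    a ^+ d * b ^+ d + a ^+ d * c ^+ d + b ^+ d * c ^+ d
      = (cheb z d).1 - ii R * (cheb z d).2 by [].
elim/nat_ind3: d {tpowE} => [||| n].
- by rewrite /=; split; ring.
- by rewrite !expr1.
- rewrite /=; split.
    have -> : z.1 * z.1 - z.2 * z.2 - z.1 *+ 2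
        + ii R * (z.1 * z.2 + z.2 * z.1 - (- z.2) *+ 2)
        = (z.1 + ii R * z.2) ^+ 2 - 2 * (z.1 - ii R * z.2) by ring: i2.
    by rewrite -e1 -e2; ring.
  have -> : z.1 * z.1 - z.2 * z.2 - z.1 *+ 2
      - ii R * (z.1 * z.2 + z.2 * z.1 - (- z.2) *+ 2)
      = (z.1 - ii R * z.2) ^+ 2 - 2 * (z.1 + ii R * z.2) by ring: i2.
  by rewrite -e1 -e2; ring: abc.
rewrite chebS; move: (cheb z n) (cheb z n.+1) (cheb z n.+2) => T0 T1 T2.
move=> [p0 q0] [p1 q1] [p2 q2] /=; split.
  transitivity ((z.1 + ii R * z.2) * (T2.1 + ii R * T2.2)
    - (z.1 - ii R * z.2) * (T1.1 + ii R * T1.2) + (T0.1 + ii R * T0.2)).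
    by rewrite -e1 -e2 -p0 -p1 -p2 !exprS; ring: abc.
  by ring: i2.
transitivity ((z.1 - ii R * z.2) * (T2.1 - ii R * T2.2)
  - (z.1 + ii R * z.2) * (T1.1 - ii R * T1.2) + (T0.1 - ii R * T0.2)).
  by rewrite -e1 -e2 -q0 -q1 -q2 !exprS; ring: abc.
by ring: i2.
Qed.

Lemma f_mapE d z : f_map d z = cheb z d.
Proof. by rewrite /f_map chebyshev_M2 M2K. Qed.

Lemma F_mapE z : F_map z = (cnorm z, ccube z).
Proof. by []. Qed.

Lemma F_map_surj (w : C * C) : exists z, F_map z = w.
Proof.
case: w => p q.
(* Eliminating y^2 = p - x^2 from the equation for q gives x^3 = q/4 + (3p/4) x. The coefficients
   beyond each list are 0 by the default of [nth]. *)
have [x xE] := @solve_monicpoly C 3 (nth 0 [:: q / 4; 3 * p / 4]) isT.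
have [y yE] := @solve_monicpoly C 2 (nth 0 [:: p - x ^+ 2]) isT.
move: xE yE; rewrite !big_ord_recl !big_ord0 /= !expr0 !mul0r !addr0 !mulr1 expr1.
move=> xE yE; exists (x, y); rewrite /F_map /= yE; congr (_, _); first by ring.
have -> : x ^+ 3 - 3 * x * (p - x ^+ 2) = 4 * x ^+ 3 - 3 * p * x by ring.
by rewrite xE; field; rewrite ?pnatr_eq0.
Qed.

Lemma eval2_ev2 (i j : 'I_2) (S : {poly {poly int}}) z :
  eval2 (map_mpoly intr (ev2 'X_i 'X_j S)) z
  = ev2 (tnth [tuple z.1; z.2] i) (tnth [tuple z.1; z.2] j) S.
Proof. by rewrite /eval2 rmorph_ev2 /= !map_mpolyX rmorph_ev2 /= !mevalXU. Qed.

End Complex.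

(** * Passage between the two encodings of integer polynomials, and the theorem *)

Lemma mpolyOver_int_ev2 (R : realType) (P : {mpoly R[2]}) :
  P \is a mpolyOver 2 Num.int -> exists W, P = ev2 'X_0 'X_1 W.
Proof.
move=> /mpolyOverP Pint.
have [W WE] := ev2_mpoly R (\sum_(m <- msupp P) Num.floor P@_m *: 'X_[m]).
exists W; rewrite -WE rmorph_sum [LHS]mpolyE; apply: eq_bigr => m _ /=.
by rewrite map_mpolyZ map_mpolyX; congr (_ *: _); apply/esym/floorK/Pint.
Qed.

Lemma in_ZpqP (R : realType) (P : {mpoly R[2]}) :
  in_Zpq P <-> exists S, P = ev2 (inv_q R) (inv_p R) S.
Proof.
split=> [[S ->]|[S ->]].
  (* Evaluation at ['X%:P] and ['X] exchanges the variables: p comes first in [in_Zpq], while q is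
     the outer variable here. *)
  have [W ->] := ev2_mpoly R S; exists (ev2 'X%:P 'X W).
  by rewrite [LHS]rmorph_ev2 /= !comp_mpolyXU /= ev2_ev2 ev2X ev2Y.
exists (ev2 'X_1 'X_0 S).
by rewrite rmorph_ev2 /= !map_mpolyX [RHS]rmorph_ev2 /= !comp_mpolyXU.
Qed.

Lemma D3_invariant_int_Zpq (R : realType) (P : {mpoly R[2]}) :
  D3_invariant P /\ P \is a mpolyOver 2 Num.int <-> in_Zpq P.
Proof.
rewrite in_ZpqP; split=> [[Pinv /mpolyOver_int_ev2[W PE]]|[S ->]].
  rewrite PE in Pinv *; have [S ->] := invariant_int_poly Pinv.
  by exists S; rewrite ev2_ev2 -inv_pE -inv_qE.
split.
  move=> g Dg; rewrite [LHS]rmorph_ev2 /=.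
  by rewrite D3_invariant_inv_p // D3_invariant_inv_q.
rewrite inv_pE inv_qE -ev2_ev2.
have -> : ev2 'X_0 'X_1 (ev2 qW pW S)
    = map_mpoly intr (ev2 'X_0 'X_1 (ev2 qW pW S)) :> {mpoly R[2]}.
  by rewrite [RHS]rmorph_ev2 /= !map_mpolyX.
by apply/mpolyOverP => m; rewrite mcoeff_map_mpoly intr_int.
Qed.

Theorem theorem3p1 (R : realType) :
  (forall P : {mpoly R[2]},
     (D3_invariant P /\ P \is a mpolyOver 2 Num.int) <-> in_Zpq P) /\
  (forall d : nat, (0 < d)%N ->
     exists g : R[i] * R[i] -> R[i] * R[i],
       unique (is_g d) g /\ defined_over_Z g).
Proof.
split=> [|d _]; first exact: D3_invariant_int_Zpq.
have [S SE] := invariant_int_poly (@D3_invariant_cnorm R d).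
have [T TE] := invariant_int_poly (@D3_invariant_ccube R d).
(* The outer variable receives q = [z.2], the inner one p = [z.1]. *)
pose g z : R[i] * R[i] := (ev2 z.2 z.1 S, ev2 z.2 z.1 T).
have gZ : defined_over_Z g.
  by exists (ev2 'X_1 'X_0 S), (ev2 'X_1 'X_0 T) => z; rewrite !eval2_ev2.
have gF z : g (F_map z) = F_map (f_map d z).
  rewrite f_mapE !F_mapE [z in cheb z]surjective_pairing.
  rewrite -ev2_cnorm_chebW -ev2_ccube_chebW SE TE !ev2_ev2.
  by rewrite ev2_pW ev2_qW.
exists g; split=> //; split=> [|g' [_ g'F]].
  split=> //; have [P [Q gE]] := gZ.
  by exists (map_mpoly intr P), (map_mpoly intr Q).
by apply: boolp.funext => w; have [z <-] := F_map_surj w; rewrite gF g'F.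
Qed.
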